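(* The problem Matrix Product Stability is algorithmically reducible to each of the following problems: Ap-WFA convergence, Ap-WFA continuity, Matrix Product Convergence, and Matrix Product Continuity.
   Context: Problems. Matrix Product Stability. Input: a finite set $\{A_a : a\in\Sigma\}$ of $n\times n$ matrices. Question: is it stable? Ap-WFA convergence. Input: an average preserving WFA $\mathcal{A}$. Question: is $f_{\mathcal{A}}$ everywhere defined on $\Sigma^\omega$? Ap-WFA continuity. Input: an average preserving WFA $\mathcal{A}$. Question: is $f_{\mathcal{A}}$ everywhere continuous on $\Sigma^\omega$ (in particular everywhere defined)? Matrix Product Convergence. Input: a finite set $\{A_a : a\in\Sigma\}$ of $n\times n$ matrices. Question: is it an RCP set? Matrix Product Continuity. Input: a finite set $\{A_a : a\in\Sigma\}$ of $n\times n$ matrices. Question: is it a continuous RCP set? Definitions. $\Sigma$ is a nonempty finite alphabet, $\Sigma^*$ the set of finite words, $\Sigma^\omega$ the set of infinite words with metric $d_C(w,w')=2^{-k}$, $k$ the length of the longest common prefix of $w\neq w'$; $\mathrm{pref}_k(w)$ is the length-$k$ prefix of $w$. For $v=v_1\cdots v_k$, $A_v=A_{v_1}\cdots A_{v_k}$. A set $\{A_a: a\in\Sigma\}$ is an RCP set if $A_w=\lim_{k\to\infty}A_{\mathrm{pref}_k(w)}$ exists for every $w\in\Sigma^\omega$; it is continuous RCP if moreover $w\mapsto A_w$ is continuous on $\Sigma^\omega$; it is stable if $A_w$ exists and equals $0$ for every $w\in\Sigma^\omega$. A WFA $\mathcal{A}$ over $\Sigma$ with $n\ge0$ states consists of $I\in\mathbb{R}^{1\times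 n}$, $F\in\mathbb{R}^{n\times1}$ and matrices $A_a\in\mathbb{R}^{n\times n}$ ($a\in\Sigma$); its $\omega$-function is $f_{\mathcal{A}}(w)=\lim_{k\to\infty}IA_{\mathrm{pref}_k(w)}F$, undefined where the limit does not exist. It is average preserving if $\sum_{a\in\Sigma}A_aF=|\Sigma|F$. Conventions. All matrix entries are given so that exact addition, multiplication, division and equality testing are algorithmic (for example, rational entries). A problem $X$ is algorithmically reducible to a problem $Y$ if there is an algorithm that decides $X$ and may call a decision procedure for $Y$ finitely many times. *)

(* Defs.v *)
From HB Require Import structures.
From mathcomp Require Import all_boot all_order all_algebra.
From mathcomp Require Import boolp classical_sets reals topology normedtype.
From mathcomp Require Import sequences.

Set Implicit Arguments.
Unset Strict Implicit.
Unset Printing Implicit Defensive.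

Import Order.TTheory GRing.Theory Num.Theory.
Import numFieldNormedType.Exports.

Local Open Scope classical_set_scope.
Local Open Scope ring_scope.

(* Programs are those of N. Jones' one-variable WHILE language over binary
   trees (a Turing-complete model of computation), written as combinators that
   transform the current value, and extended with an oracle instruction. *)
Inductive data := Leaf | Node of data & data.

Definition hd (d : data) := if d is Node d1 _ then d1 else Leaf.
Definition tl (d : data) := if d is Node _ d2 then d2 else Leaf.

Definition bool_data (b : bool) := if b then Node Leaf Leaf else Leaf.

Inductive program :=
  | Id
  | Nil
  | Hd
  | Tl
  | Cons of program & program
  | Seq of program & program
  | If of program & program & program
  | While of program & program
  | Ask.

(* [exec Q p d e]: on input [d] the program [p] halts with result [e].  The
   relation [Q] is the oracle: if [Q d b] does not hold for any [b], then asking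
   about [d] never returns.  A halting run asks finitely many questions, since
   derivations are finite. *)
Inductive exec (Q : data -> bool -> Prop) : program -> data -> data -> Prop :=
  | EvalId d : exec Q Id d d
  | EvalNil d : exec Q Nil d Leaf
  | EvalHd d : exec Q Hd d (hd d)
  | EvalTl d : exec Q Tl d (tl d)
  | EvalCons p q d e f :
      exec Q p d e -> exec Q q d f -> exec Q (Cons p q) d (Node e f)
  | EvalSeq p q d e f :
      exec Q p d e -> exec Q q e f -> exec Q (Seq p q) d f
  | EvalIfTrue c p q d e1 e2 f :
      exec Q c d (Node e1 e2) -> exec Q p d f -> exec Q (If c p q) d f
  | EvalIfFalse c p q d f :
      exec Q c d Leaf -> exec Q q d f -> exec Q (If c p q) d f
  | EvalWhileTrue c p d e1 e2 d' f :
      exec Q c d (Node e1 e2) -> exec Q p d d' -> exec Q (While c p) d' f ->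
      exec Q (While c p) d f
  | EvalWhileFalse c p d :
      exec Q c d Leaf -> exec Q (While c p) d d
  | EvalAsk d b : Q d b -> exec Q Ask d (bool_data b).

Definition no_oracle (d : data) (b : bool) : Prop := False.

Record problem := Problem {
  input : Type;
  encodes : data -> input -> Prop;
  yes : input -> Prop
}.

(* A decision procedure for [Y] need only respond to codes of inputs of [Y]. *)
Definition oracle (Y : problem) (d : data) (b : bool) : Prop :=
  exists y : input Y, encodes d y /\ (b <-> yes y).

Definition reducible (X Y : problem) : Prop :=
  exists p : program, forall (d : data) (x : input X), encodes d x ->
    exists b : bool, exec (oracle Y) p d (bool_data b) /\ (b <-> yes x).

(* [names d x]: the tree [d] is a code of the number [x]; a number may have
   several codes.  The numbers that have a code form a subfield of [R] on which
   arithmetic and equality testing are algorithmic. *)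
Record effective_field (R : realType) (names : data -> R -> Prop) : Prop := {
  names_functional : forall d x y, names d x -> names d y -> x = y;
  names_subfield : divring_closed [pred x : R | `[< exists d, names d x >]];
  names_add : exists p, forall c d x y, names c x -> names d y ->
    exists e, exec no_oracle p (Node c d) e /\ names e (x + y);
  names_mul : exists p, forall c d x y, names c x -> names d y ->
    exists e, exec no_oracle p (Node c d) e /\ names e (x * y);
  names_div : exists p, forall c d x y, names c x -> names d y -> y != 0 ->
    exists e, exec no_oracle p (Node c d) e /\ names e (x / y);
  names_eq : exists p, forall c d x y, names c x -> names d y ->
    exec no_oracle p (Node c d) (bool_data (x == y))
}.

Fixpoint nat_data (n : nat) : data :=
  if n is m.+1 then Node Leaf (nat_data m) else Leaf.

Fixpoint names_seq (T : Type) (r : data -> T -> Prop) (d : data) (s : seq T) :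
    Prop :=
  match d, s with
  | Leaf, [::] => True
  | Node d1 d2, x :: s' => r d1 x /\ names_seq r d2 s'
  | _, _ => False
  end.

Definition names_matrix (R : realType) (names : data -> R -> Prop) (m n : nat)
    (d : data) (A : 'M[R]_(m, n)) : Prop :=
  names_seq (names_seq names) d
    [seq [seq A i j | j <- enum 'I_n] | i <- enum 'I_m].

Definition pref (Sigma : finType) (k : nat) (w : nat -> Sigma) : seq Sigma :=
  mkseq w k.

(* The length of the longest common prefix of two distinct words is the least
   [k] such that their prefixes of length [k.+1] differ. *)
Definition dC (R : realType) (Sigma : finType) (w w' : nat -> Sigma) : R :=
  if pselect (exists k, pref k.+1 w != pref k.+1 w') is left neq_ww'
  then 2^-1 ^+ ex_minn neq_ww' else 0.

Definition dC_continuous (R : realType) (Sigma : finType)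
    (T : pseudoMetricType R) (f : (nat -> Sigma) -> T) : Prop :=
  forall (w : nat -> Sigma) (e : R), 0 < e ->
    exists2 delta : R, 0 < delta &
      forall w', dC R w w' < delta -> ball (f w) e (f w').

Section MatrixProducts.
Context (R : realType) (Sigma : finType) (n : nat) (A : Sigma -> 'M[R]_n).

Definition word_mx (v : seq Sigma) : 'M[R]_n := \big[mulmx/1%:M]_(a <- v) A a.

Definition RCP : Prop :=
  forall w : nat -> Sigma, cvg ((fun k => word_mx (pref k w)) @ \oo).

Definition limit_mx (w : nat -> Sigma) : 'M[R]_n :=
  lim ((fun k => word_mx (pref k w)) @ \oo).

Definition continuous_RCP : Prop := RCP /\ dC_continuous limit_mx.

Definition stable : Prop := RCP /\ forall w : nat -> Sigma, limit_mx w = 0.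

End MatrixProducts.

Record wfa (R : realType) (Sigma : finType) (n : nat) := Wfa {
  initial : 'rV[R]_n;
  final : 'cV[R]_n;
  trans : Sigma -> 'M[R]_n
}.

Section Automata.
Context (R : realType) (Sigma : finType) (n : nat) (A : wfa R Sigma n).

Definition average_preserving : Prop :=
  \sum_(a : Sigma) trans A a *m final A = #|Sigma|%:R *: final A.

Definition prefix_weight (w : nat -> Sigma) (k : nat) : R :=
  (initial A *m word_mx (trans A) (pref k w) *m final A) 0 0.

Definition omega_defined : Prop :=
  forall w : nat -> Sigma, cvg (prefix_weight w @ \oo).

Definition omega_function (w : nat -> Sigma) : R := lim (prefix_weight w @ \oo).

Definition omega_continuous : Prop :=
  omega_defined /\ dC_continuous omega_function.

End Automata.

(* In inputs, the nonempty finite alphabet is {0, ..., k} for some [k]. *)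
Record matrix_family (R : realType) := MatrixFamily {
  mf_alph : nat;
  mf_dim : nat;
  mf_mx :> 'I_mf_alph.+1 -> 'M[R]_mf_dim
}.

Record apwfa (R : realType) := ApWfa {
  ap_alph : nat;
  ap_dim : nat;
  ap_wfa :> wfa R 'I_ap_alph.+1 ap_dim;
  ap_average_preserving : average_preserving ap_wfa
}.

Section Problems.
Context (R : realType) (names : data -> R -> Prop).

Definition names_family (d : data) (n k : nat) (A : 'I_k.+1 -> 'M[R]_n) : Prop :=
  names_seq (@names_matrix R names n n) d [seq A a | a <- enum 'I_k.+1].

Definition encodes_matrix_family (d : data) (A : matrix_family R) : Prop :=
  exists dA : data, d = Node (nat_data (mf_dim A)) dA /\ names_family dA A.

Definition encodes_apwfa (d : data) (A : apwfa R) : Prop :=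
  exists dI dF dA : data,
    [/\ d = Node (nat_data (ap_dim A)) (Node dI (Node dF dA)),
        names_matrix names dI (initial A),
        names_matrix names dF (final A) &
        names_family dA (trans A)].

Definition matrix_product_stability : problem :=
  Problem encodes_matrix_family (fun A => stable A).

Definition matrix_product_convergence : problem :=
  Problem encodes_matrix_family (fun A => RCP A).

Definition matrix_product_continuity : problem :=
  Problem encodes_matrix_family (fun A => continuous_RCP A).

Definition apwfa_convergence : problem :=
  Problem encodes_apwfa (fun A => omega_defined A).

Definition apwfa_continuity : problem :=
  Problem encodes_apwfa (fun A => omega_continuous A).

End Problems.

(* Main.v *)
(* Given a family A of n x n matrices, take as new letters the pairs (v, a)
   where a is a letter of A and v ranges over 0, e_1, ..., e_n and their
   opposites, and let

     M_(v,a) = [[0, 0, v], [0, 1, 0], [0, v^T, A_a]],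
     I = (1, 0, 0),   F = (0, 1, 0)^T.

   The opposite vectors cancel, so (I, M, F) is average preserving.  The weight
   of (v_0, a_0) ... (v_k, a_k) is the sum over 0 < j <= k of
   v_0 A_(a_1 ... a_(j-1)) v_j^T.  If these weights converge along every
   infinite word, then their increments, which include all the entries of
   A_(a_1 ... a_k), tend to 0, so A is stable.  Conversely, if A is stable then
   by Konig's lemma the sums of |A_(a_1 ... a_j)| over j are bounded uniformly
   in the word, whence all products of the M_(v,a) converge, with a continuous
   limit.  So this one construction serves all four problems; its entries are
   those of A and the constants 0, 1, -1, hence no arithmetic is needed. *)

Require Import Defs.
From mathcomp Require Import all_boot all_order all_algebra.
From mathcomp Require Import boolp classical_sets reals topology normedtype.
From mathcomp Require Import sequences zify lra.

Set Implicit Arguments.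
Unset Strict Implicit.
Unset Printing Implicit Defensive.

Import Order.TTheory GRing.Theory Num.Theory.
Import numFieldNormedType.Exports.
(* Restores [Cons], [Nil] and [Seq], which MathComp also uses. *)
Import Defs.

Local Open Scope classical_set_scope.
Local Open Scope ring_scope.

(** * Realizability by programs *)

Section Realizability.
Local Open Scope nat_scope.

Definition names_pair (X Y : Type) (r : data -> X -> Prop)
    (s : data -> Y -> Prop) (d : data) (z : X * Y) : Prop :=
  if d is Node d1 d2 then r d1 z.1 /\ s d2 z.2 else False.

(** The program must work under every oracle [Q], so it asks nothing essential and can be run inside
    a reduction to any problem. The code it returns may depend on the code [d], not only on [x]. *)
Definition realizes (X Y : Type) (r : data -> X -> Prop)
    (s : data -> Y -> Prop) (f : X -> Y) : Prop :=
  exists p, forall Q d x, r d x -> exists2 e, exec Q p d e & s e (f x).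

Fixpoint quote (d : data) : program :=
  if d is Node d1 d2 then Cons (quote d1) (quote d2) else Nil.

Lemma exec_quote Q e d : exec Q (quote e) d e.
Proof. by elim: e => [|e1 IH1 e2 IH2] /=; constructor. Qed.

Context (X : Type) (r : data -> X -> Prop).

Lemma realizes_id : realizes r r id.
Proof. by exists Id => Q d x rx; exists d => //; constructor. Qed.

Lemma realizes_const (Y : Type) (s : data -> Y -> Prop) e y :
  s e y -> realizes r s (fun=> y).
Proof.
by move=> sy; exists (quote e) => Q d x _; exists e => //; apply: exec_quote.
Qed.

Lemma realizes_comp (Y Z : Type) (s : data -> Y -> Prop)
    (t : data -> Z -> Prop) (f : X -> Y) (g : Y -> Z) :
  realizes r s f -> realizes s t g -> realizes r t (g \o f).
Proof.
move=> [p pP] [q qP]; exists (Seq p q) => Q d x rx.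
have [e de se] := pP Q d x rx; have [e' ee' te'] := qP Q e _ se.
by exists e' => //; apply: EvalSeq de ee'.
Qed.

Lemma realizes_pair (Y Z : Type) (s : data -> Y -> Prop)
    (t : data -> Z -> Prop) (f : X -> Y) (g : X -> Z) :
  realizes r s f -> realizes r t g ->
  realizes r (names_pair s t) (fun x => (f x, g x)).
Proof.
move=> [p pP] [q qP]; exists (Cons p q) => Q d x rx.
have [e de se] := pP Q d x rx; have [e' de' te'] := qP Q d x rx.
by exists (Node e e') => //; constructor.
Qed.

Lemma realizes_fst (Y Z : Type) (s : data -> Y -> Prop)
    (t : data -> Z -> Prop) (f : X -> Y * Z) :
  realizes r (names_pair s t) f -> realizes r s (fun x => (f x).1).
Proof.
move=> /realizes_comp; apply; exists Hd => Q [//|d1 d2] z [sz _].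
by exists d1 => //; apply: EvalHd.
Qed.

Lemma realizes_snd (Y Z : Type) (s : data -> Y -> Prop)
    (t : data -> Z -> Prop) (f : X -> Y * Z) :
  realizes r (names_pair s t) f -> realizes r t (fun x => (f x).2).
Proof.
move=> /realizes_comp; apply; exists Tl => Q [//|d1 d2] z [_ tz].
by exists d2 => //; apply: EvalTl.
Qed.

Lemma realizes_cons (Y : Type) (s : data -> Y -> Prop) (f : X -> Y)
    (l : X -> seq Y) :
  realizes r s f -> realizes r (names_seq s) l ->
  realizes r (names_seq s) (fun x => f x :: l x).
Proof.
move=> [p pP] [q qP]; exists (Cons p q) => Q d x rx.
have [e de se] := pP Q d x rx; have [e' de' te'] := qP Q d x rx.
by exists (Node e e') => //; constructor.
Qed.

Lemma realizes_nil (Y : Type) (s : data -> Y -> Prop) :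
  realizes r (names_seq s) (fun=> [::]).
Proof. exact: (@realizes_const _ _ Leaf). Qed.

(** A list is coded by [Leaf] exactly when it is empty, so [If] on its code performs the case
    analysis. *)
Lemma realizes_match (Y Z : Type) (s : data -> Y -> Prop)
    (t : data -> Z -> Prop) (l : X -> seq Y) (f : X -> Y -> seq Y -> Z)
    (b : X -> Z) :
  realizes r (names_seq s) l ->
  realizes (names_pair r (names_pair s (names_seq s))) t
    (fun z => f z.1 z.2.1 z.2.2) ->
  realizes r t b ->
  realizes r t (fun x => if l x is y :: l' then f x y l' else b x).
Proof.
move=> [pl plP] [pf pfP] [pb pbP]; exists (If pl (Seq (Cons Id pl) pf) pb).
move=> Q d x rx; have [e de] := plP Q d x rx.
case: e de => [|e1 e2] de; case: (l x) => [|y l'] //=.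
- by move=> _; have [e' de' te'] := pbP Q d x rx; exists e' => //;
    apply: EvalIfFalse.
- move=> sl; have [|e' ee' te'] := pfP Q (Node d (Node e1 e2)) (x, (y, l')).
    by [].
  exists e' => //; apply: (EvalIfTrue _ de).
  exact: EvalSeq (EvalCons (EvalId _ _) de) ee'.
Qed.

Lemma realizes_foldl (Y Z : Type) (s : data -> Y -> Prop)
    (t : data -> Z -> Prop) (l : X -> seq Y) (f : X -> Z -> Y -> Z)
    (b : X -> Z) :
  realizes r (names_seq s) l -> realizes r t b ->
  realizes (names_pair r (names_pair t s)) t (fun z => f z.1 z.2.1 z.2.2) ->
  realizes r t (fun x => foldl (f x) (b x) (l x)).
Proof.
move=> [pl plP] [pb pbP] [pf pfP].
(* The loop state is [Node d (Node c dl)]: the input, the accumulator, and the rest of the list. The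
   guard [Seq Tl Tl] reads [dl], which is [Leaf] once the list is exhausted. *)
pose body := Cons Hd (Cons
  (Seq (Cons Hd (Cons (Seq Tl Hd) (Seq Tl (Seq Tl Hd)))) pf)
  (Seq Tl (Seq Tl Tl))).
have loop Q d x : r d x -> forall ys y dl c, names_seq s dl ys -> t c y ->
    exists e c', [/\ exec Q (While (Seq Tl Tl) body) (Node d (Node c dl))
      (Node d (Node c' e)) & t c' (foldl (f x) y ys)].
  move=> rx; elim=> [|y0 ys IH] y [|d1 d2] c //=.
    move=> _ ty; exists Leaf, c; split=> //; apply: EvalWhileFalse.
    by apply: EvalSeq; apply: EvalTl.
  move=> [sy0 sys] ty.
  have [|e de te] := pfP Q (Node d (Node c d1)) (x, (y, y0)); first by [].
  have [e' [c' [ex tc']]] := IH _ _ _ sys te.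
  exists e', c'; split=> //; apply: EvalWhileTrue ex.
    by apply: EvalSeq; apply: EvalTl.
  have tlE d0 e0 : e0 = tl d0 -> exec Q Tl d0 e0 by move=> ->; constructor.
  have hdE d0 e0 : e0 = hd d0 -> exec Q Hd d0 e0 by move=> ->; constructor.
  apply: EvalCons; first exact: hdE.
  apply: EvalCons; last first.
    apply: EvalSeq (EvalTl _ _) _; apply: EvalSeq (EvalTl _ _) _; exact: tlE.
  apply: EvalSeq de; apply: EvalCons; first exact: hdE.
  apply: EvalCons; first by apply: EvalSeq (EvalTl _ _) _; exact: hdE.
  by apply: EvalSeq (EvalTl _ _) _; apply: EvalSeq (EvalTl _ _) _; exact: hdE.
exists (Seq (Cons Id (Cons pb pl)) (Seq (While (Seq Tl Tl) body) (Seq Tl Hd))).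
move=> Q d x rx; have [c dc tc] := pbP Q d x rx.
have [dl ddl sl] := plP Q d x rx.
have [e [c' [ex tc']]] := loop Q d x rx _ _ _ _ sl tc.
exists c' => //; apply: (@EvalSeq _ _ _ _ (Node d (Node c dl))).
  exact: EvalCons (EvalId _ _) (EvalCons dc ddl).
apply: EvalSeq ex _; apply: (EvalSeq (EvalTl _ _)).
exact: (EvalHd _ (Node c' e)).
Qed.

End Realizability.

Lemma realizes_ext (X Y : Type) (r : data -> X -> Prop) (s : data -> Y -> Prop)
    (f g : X -> Y) : f =1 g -> realizes r s f -> realizes r s g.
Proof. by move=> /funext->. Qed.

(** * Programs for list operations *)

Section RealizabilitySeq.
Context (X : Type) (r : data -> X -> Prop).

Lemma realizes_rev (Y : Type) (s : data -> Y -> Prop) (l : X -> seq Y) :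
  realizes r (names_seq s) l -> realizes r (names_seq s) (fun x => rev (l x)).
Proof.
move=> rl.
apply: (@realizes_ext _ _ _ _ (fun x => foldl (fun a y => y :: a) [::] (l x))).
  move=> x; rewrite /rev; elim: (l x) [::] => //= y l' IH a.
apply: realizes_foldl rl (realizes_nil _ _) _.
apply: realizes_cons; first exact/realizes_snd/realizes_snd/realizes_id.
exact/realizes_fst/realizes_snd/realizes_id.
Qed.

(** A left fold over the reversed list, which avoids a second loop. *)
Lemma realizes_foldr (Y Z : Type) (s : data -> Y -> Prop)
    (t : data -> Z -> Prop) (l : X -> seq Y) (f : X -> Y -> Z -> Z)
    (b : X -> Z) :
  realizes r (names_seq s) l -> realizes r t b ->
  realizes (names_pair r (names_pair s t)) t (fun z => f z.1 z.2.1 z.2.2) ->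
  realizes r t (fun x => foldr (f x) (b x) (l x)).
Proof.
move=> rl rb rf; apply: (@realizes_ext _ _ _ _
  (fun x => foldl (fun z y => f x y z) (b x) (rev (l x)))) => [x|].
  by rewrite foldl_rev.
apply: (realizes_foldl (f := fun x z y => f x y z) (realizes_rev rl) rb).
apply: (realizes_comp (f := fun z => (z.1, (z.2.2, z.2.1)))) rf.
have [rz rz2] := (realizes_id (names_pair r (names_pair t s)),
  realizes_snd (realizes_id (names_pair r (names_pair t s)))).
apply: realizes_pair (realizes_fst rz) _.
exact: realizes_pair (realizes_snd rz2) (realizes_fst rz2).
Qed.

Lemma realizes_cat (Y : Type) (s : data -> Y -> Prop) (l m : X -> seq Y) :
  realizes r (names_seq s) l -> realizes r (names_seq s) m ->
  realizes r (names_seq s) (fun x => l x ++ m x).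
Proof.
move=> rl rm; apply: (@realizes_ext _ _ _ _ (fun x => foldr cons (m x) (l x))).
  by move=> x; elim: (l x) => //= y l' ->.
apply: realizes_foldr rl rm _; apply: realizes_cons.
  exact/realizes_fst/realizes_snd/realizes_id.
exact/realizes_snd/realizes_snd/realizes_id.
Qed.

Lemma realizes_map (Y Z : Type) (s : data -> Y -> Prop)
    (t : data -> Z -> Prop) (l : X -> seq Y) (f : X -> Y -> Z) :
  realizes r (names_seq s) l ->
  realizes (names_pair r s) t (fun z => f z.1 z.2) ->
  realizes r (names_seq t) (fun x => [seq f x y | y <- l x]).
Proof.
move=> rl rf; apply: (@realizes_foldr _ _ s (names_seq t) l
  (fun x y => cons (f x y)) (fun=> [::]) rl (realizes_nil _ _)).
apply: realizes_cons; last exact/realizes_snd/realizes_snd/realizes_id.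
apply: (realizes_comp (f := fun z => (z.1, z.2.1))) rf.
apply: realizes_pair; first exact/realizes_fst/realizes_id.
exact/realizes_fst/realizes_snd/realizes_id.
Qed.

End RealizabilitySeq.

Lemma realizes_flatten (X Y : Type) (r : data -> X -> Prop)
    (s : data -> Y -> Prop) (l : X -> seq (seq Y)) :
  realizes r (names_seq (names_seq s)) l ->
  realizes r (names_seq s) (fun x => flatten (l x)).
Proof.
move=> rl; apply: (realizes_foldr (f := fun=> cat) rl (realizes_nil _ _)).
apply: realizes_cat; first exact/realizes_fst/realizes_snd/realizes_id.
exact/realizes_snd/realizes_snd/realizes_id.
Qed.

Lemma realizes_zip (X Y Z : Type) (r : data -> X -> Prop)
    (s : data -> Y -> Prop) (t : data -> Z -> Prop)
    (l : X -> seq Y) (m : X -> seq Z) :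
  realizes r (names_seq s) l -> realizes r (names_seq t) m ->
  realizes r (names_seq (names_pair s t)) (fun x => zip (l x) (m x)).
Proof.
move=> rl rm.
(* The fold runs over [m x]; its state holds the pairs found so far, in reverse, and the unread part
   of [l x]. Once that part is empty the state is frozen, which matches the truncation done by
   [zip]. *)
pose step (st : seq (Y * Z) * seq Y) z :=
  if st.2 is y :: l' then ((y, z) :: st.1, l') else st.
apply: (@realizes_ext _ _ _ _
    (fun x => rev (foldl step ([::], l x) (m x)).1)) => [x|].
  rewrite -[RHS]cat0s -[[::] in RHS]/(rev [::]).
  elim: (m x) (l x) [::] => [|z m' IH] [|y l'] a //=; rewrite ?cats0 //.
    by rewrite {}IH; case: m' => [|? ?]; rewrite /= cats0.
  by rewrite IH rev_cons cat_rcons.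
apply: realizes_rev; apply: realizes_fst.
have rpair := realizes_pair (realizes_nil _ _) rl.
apply: (realizes_foldl (f := fun=> step) rm (rpair _ (names_pair s t))).
apply: (realizes_match
  (f := fun z y l' => ((y, z.2.2) :: z.2.1.1, l'))).
- exact/realizes_snd/realizes_fst/realizes_snd/realizes_id.
- apply: realizes_pair; last exact/realizes_snd/realizes_snd/realizes_id.
  apply: realizes_cons.
    apply: realizes_pair; first exact/realizes_fst/realizes_snd/realizes_id.
    exact/realizes_snd/realizes_snd/realizes_fst/realizes_id.
  exact/realizes_fst/realizes_fst/realizes_snd/realizes_fst/realizes_id.
- exact/realizes_fst/realizes_snd/realizes_id.
Qed.

(** * Programs listing the new matrices *)

(** The vectors c e_1, ..., c e_n, followed by the zero vector. The latter keeps the new alphabet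
    nonempty when [n] is 0. *)
Fixpoint scaled_units (R : pzRingType) (c : R) (n : nat) : seq (seq R) :=
  if n is m.+1 then (c :: nseq m 0) :: [seq 0 :: v | v <- scaled_units c m]
  else [:: [::]].

(** The matrix M_(v,A) row by row. Zipping [v] with the rows of [A] places v^T in the second
    column. *)
Definition letter_rows (R : pzRingType) (n : nat) (v : seq R)
    (A : seq (seq R)) : seq (seq R) :=
  [:: 0, 0 & v] :: [:: 0, 1 & nseq n 0] ::
  [seq [:: 0, x.1 & x.2] | x <- zip v A].

Definition letters (R : pzRingType) (T : Type) (n : nat) (s : seq T) :
    seq (seq R * T) :=
  [seq (v, a) | v <- scaled_units 1 n ++ scaled_units (-1) n, a <- s].

Section Programs.
Context (R : realType) (names : data -> R -> Prop).
Hypothesis hK : effective_field names.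

(** A subfield contains 1, and differences then give 0 and -1. Codes of these constants are built
    into the programs. *)
Lemma names_0N1 : [/\ exists d, names d 0, exists d, names d 1 &
  exists d, names d (-1)].
Proof.
have [n1 nB _] := names_subfield hK.
have n0 := nB _ _ n1 n1; rewrite subrr in n0.
have nN1 := nB _ _ n0 n1; rewrite sub0r in nN1.
by split; apply/asboolP; [exact: n0 | exact: n1 | exact: nN1].
Qed.

(** With [Leaf] as the only code of [tt], the code of a list of [n] units is [nat_data n]. Recursion
    on a dimension thus becomes a fold over a list. *)
Definition names_unit (d : data) (_ : unit) : Prop := d = Leaf.

Section Letters.
Context (X : Type) (r : data -> X -> Prop) (n : X -> nat).
Hypothesis rn : realizes r (names_seq names_unit) (fun x => nseq (n x) tt).

Lemma realizes_nseq (Y : Type) (s : data -> Y -> Prop) e y :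
  s e y -> realizes r (names_seq s) (fun x => nseq (n x) y).
Proof.
move=> sy; apply: (@realizes_ext _ _ _ _
  (fun x => [seq y | _ <- nseq (n x) tt])) => [x|].
  by rewrite map_nseq.
by apply: (realizes_map (f := fun _ _ => y) rn); apply: realizes_const sy.
Qed.

Lemma realizes_scaled_units e c :
  names e c ->
  realizes r (names_seq (names_seq names)) (fun x => scaled_units c (n x)).
Proof.
move=> ec; have [[d0 e0] _ _] := names_0N1.
(* The zero list of the current length is carried along, because each new first vector is [c]
   followed by those zeros. *)
pose step (_ : unit) (zu : seq R * seq (seq R)) :=
  (0 :: zu.1, (c :: zu.1) :: [seq 0 :: v | v <- zu.2]).
apply: (@realizes_ext _ _ _ _
    (fun x => (foldr step ([::], [:: [::]]) (nseq (n x) tt)).2)) => [x|].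
  suff -> : foldr step ([::], [:: [::]]) (nseq (n x) tt) =
    (nseq (n x) 0, scaled_units c (n x)) by [].
  by elim: (n x) => //= m ->.
have rnil Y (s : data -> Y -> Prop) := realizes_nil r s.
have rb := realizes_pair (rnil _ names)
  (realizes_cons (rnil _ names) (rnil _ (names_seq names))).
apply: realizes_snd; apply: (realizes_foldr (f := fun=> step) rn rb).
have rz := realizes_fst (realizes_snd (realizes_snd (realizes_id (names_pair r
  (names_pair names_unit
    (names_pair (names_seq names) (names_seq (names_seq names)))))))).
apply: realizes_pair.
  by apply: realizes_cons rz; apply: realizes_const e0.
apply: realizes_cons.
  by apply: realizes_cons rz; apply: realizes_const ec.
apply: (realizes_map (f := fun=> cons 0)).
  exact/realizes_snd/realizes_snd/realizes_snd/realizes_id.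
apply: realizes_cons; first exact: realizes_const e0.
exact/realizes_snd/realizes_id.
Qed.

Lemma realizes_letter_rows (v : X -> seq R) (A : X -> seq (seq R)) :
  realizes r (names_seq names) v ->
  realizes r (names_seq (names_seq names)) A ->
  realizes r (names_seq (names_seq names))
    (fun x => letter_rows (n x) (v x) (A x)).
Proof.
move=> rv rA; have [[d0 e0] [d1 e1] _] := names_0N1.
have r0 Y (s : data -> Y -> Prop) := realizes_const s e0.
have r1 Y (s : data -> Y -> Prop) := realizes_const s e1.
apply: realizes_cons; first by do 2!apply: realizes_cons => //.
apply: realizes_cons.
  by do 2!apply: realizes_cons => //; apply: realizes_nseq e0.
apply: (realizes_map (f := fun _ x => [:: 0, x.1 & x.2]) (realizes_zip rv rA)).
apply: realizes_cons => //; apply: realizes_cons.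
  exact/realizes_fst/realizes_snd/realizes_id.
exact/realizes_snd/realizes_snd/realizes_id.
Qed.

End Letters.

Lemma realizes_letters_rows :
  realizes (names_pair (names_seq names_unit)
      (names_seq (names_seq (names_seq names))))
    (names_seq (names_seq (names_seq names)))
    (fun x => [seq letter_rows (size x.1) p.1 p.2 |
      p <- letters R (size x.1) x.2]).
Proof.
have [_ [d1 e1] [dN eN]] := names_0N1.
set r := names_pair _ _.
have nseqE (u : seq unit) : u = nseq (size u) tt by elim: u => //= -[] u <-.
apply: (@realizes_ext _ _ _ _ (fun x => flatten [seq
    [seq letter_rows (size x.1) v A | A <- x.2] |
     v <- scaled_units 1 (size x.1) ++ scaled_units (-1) (size x.1)])) => [x|].
  rewrite /letters; elim: (_ ++ _) => //= v vs IH.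
  by rewrite map_cat -map_comp IH.
have rn : realizes r (names_seq names_unit) (fun x => nseq (size x.1) tt).
  by apply: realizes_ext (realizes_fst (realizes_id r)) => x /=.
apply: realizes_flatten.
apply: (realizes_map
  (f := fun x v => [seq letter_rows (size x.1) v A | A <- x.2])).
  by apply: realizes_cat; apply: realizes_scaled_units; eauto.
apply: (realizes_map (f := fun x A => letter_rows (size x.1.1) x.2 A)).
  exact/realizes_snd/realizes_fst/realizes_id.
apply: (realizes_letter_rows (n := fun z => size z.1.1.1)).
- apply: (@realizes_comp _ _ _ _ _ _ (fun z => z.1.1)) rn.
  exact/realizes_fst/realizes_fst/realizes_id.
- exact/realizes_snd/realizes_fst/realizes_id.
- exact/realizes_snd/realizes_id.
Qed.
End Programs.

(** * Infinite words *)

Section Words.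
Context (S : finType).
Implicit Types (w : nat -> S) (u v : seq S).

Lemma prefS k w : pref k.+1 w = rcons (pref k w) (w k).
Proof. exact: mkseqS. Qed.

Lemma size_pref k w : size (pref k w) = k.
Proof. exact: size_mkseq. Qed.

Lemma prefSl k w : pref k.+1 w = w 0%N :: pref k (w \o succn).
Proof.
by elim: k => // k IH; rewrite prefS IH (prefS k (w \o succn)).
Qed.

Lemma prefD j k w : pref (j + k) w = pref j w ++ pref k (fun i => w (j + i)%N).
Proof.
by elim: k => [|k IH]; rewrite ?addn0 ?cats0 // addnS !prefS IH rcons_cat.
Qed.

Lemma map_pref (T : finType) (f : S -> T) k w :
  map f (pref k w) = pref k (f \o w).
Proof. by rewrite /pref /mkseq -map_comp. Qed.

(** Call [v] good if a uniform bound exists for the continuations of [v]. If all one-letter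
    extensions of [v] are good, so is [v], the alphabet being finite; hence a bad empty word would
    start an infinite word with only bad prefixes. *)
Lemma konig (P : seq S -> Prop) :
  (forall w, exists k, P (pref k w)) ->
  exists N, forall u, (N <= size u)%N -> exists2 j, (j <= N)%N & P (take j u).
Proof.
move=> Pw; pose good v := exists N, forall u, (N <= size u)%N ->
  exists2 j, (j <= size v + N)%N & P (take j (v ++ u)).
suff: good [::] by [].
apply: contrapT => bad0.
have bad_rcons v : ~ good v -> exists a, ~ good (rcons v a).
  move=> bad; apply: contrapT => /forallNP good_rcons; apply: bad.
  have /fin_all_exists[N NP] a : good (rcons v a).
    exact: contrapT (good_rcons a).
  (* The extra 1 makes the continuation nonempty, so that its first letter can be moved to [v]. *)
  exists (\max_a N a).+1 => -[//|a u] /=; rewrite ltnS => leu.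
  have leN : (N a <= \max_a N a)%N by exact: leq_bigmax.
  have [j] := NP a u (leq_trans leN leu).
  rewrite size_rcons addSn cat_rcons => lej Pj; exists j => //.
  by rewrite addnS (leq_trans lej)// ltnS leq_add2l.
have [a0 _] := bad_rcons _ bad0.
have /choice[f fP] : forall v, exists a, ~ good v -> ~ good (rcons v a).
  move=> v; have [|/bad_rcons[a]] := pselect (good v); last by exists a.
  by exists a0.
pose vs k := iter k (fun v => rcons v (f v)) [::].
have badvs k : ~ good (vs k) by elim: k => // k; apply: fP.
(* A prefix satisfying [P] is good with bound 0, although every prefix of this word is bad. *)
have [k Pk] := Pw (fun k => f (vs k)).
apply: (badvs k); exists 0%N => u _; exists (size (vs k)).
  by rewrite addn0.
rewrite take_size_cat//; suff -> : vs k = pref k (fun k => f (vs k)) by [].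
by elim: {Pk} k => // k IH; rewrite prefS -IH.
Qed.

Lemma dC_lt_pref (R : realType) w w' k :
  dC R w w' < 2^-1 ^+ k -> pref k w' = pref k w.
Proof.
rewrite /dC; case: pselect => [neq|eqw].
  case: ex_minnP => m _ minm; rewrite ltr_iXn2l ?invr_gt0 ?invf_lt1 ?ltr1n//.
  case: k => // k; move=> /ltnW ltkm.
  apply/eqP; rewrite eq_sym; apply/negPn/negP => /minm.
  by rewrite leqNgt ltkm.
(* Here [dC] takes its default value 0, because all prefixes agree. *)
move=> _; apply/eqP; rewrite eq_sym; apply/negPn/negP.
case: k => [/eqP//|k] neq.
by apply: eqw; exists k.
Qed.

End Words.

(** * Products of stable families *)

Section Norm.
Context (R : realType).

(** The entrywise 1-norm: it is submultiplicative, as the maximum of the absolute entries is not,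
    and additive over blocks. *)
Definition nrm (m n : nat) (A : 'M[R]_(m, n)) : R := \sum_i \sum_j `|A i j|.

Lemma nrm_ge0 m n (A : 'M[R]_(m, n)) : 0 <= nrm A.
Proof. by do 2!apply: sumr_ge0 => ? _. Qed.

Lemma entry_le_nrm m n (A : 'M[R]_(m, n)) i j : `|A i j| <= nrm A.
Proof.
rewrite /nrm (bigD1 i)//= (bigD1 j)//= -addrA lerDl.
by apply: addr_ge0; apply: sumr_ge0 => ? _ //; apply: sumr_ge0.
Qed.

Lemma nrm0 m n : nrm (0 : 'M[R]_(m, n)) = 0.
Proof.
by rewrite /nrm big1// => i _; rewrite big1// => j _; rewrite mxE normr0.
Qed.

Lemma ler_nrmD m n (A B : 'M[R]_(m, n)) : nrm (A + B) <= nrm A + nrm B.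
Proof.
rewrite -big_split; apply: ler_sum => i _; rewrite -big_split.
by apply: ler_sum => j _; rewrite mxE ler_normD.
Qed.

Lemma nrmN m n (A : 'M[R]_(m, n)) : nrm (- A) = nrm A.
Proof. by do 2!apply: eq_bigr => ? _; rewrite mxE normrN. Qed.

Lemma nrm_tr m n (A : 'M[R]_(m, n)) : nrm A^T = nrm A.
Proof.
rewrite /nrm exchange_big; apply: eq_bigr => i _.
by apply: eq_bigr => j _; rewrite mxE.
Qed.

Lemma nrm_mul m n p (A : 'M[R]_(m, n)) (B : 'M[R]_(n, p)) :
  nrm (A *m B) <= nrm A * nrm B.
Proof.
rewrite mulr_suml; apply: ler_sum => i _.
apply: (@le_trans _ _ (\sum_k \sum_j `|A i j| * `|B j k|)).
  apply: ler_sum => k _; rewrite mxE (le_trans (ler_norm_sum _ _ _))//.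
  by apply: ler_sum => j _; rewrite normrM.
rewrite exchange_big mulr_suml; apply: ler_sum => j _.
rewrite -mulr_sumr ler_wpM2l// /nrm [leRHS](bigD1 j)//= lerDl.
by apply: sumr_ge0 => ? _; apply: sumr_ge0.
Qed.

Lemma nrm_row_mx m n p (A : 'M[R]_(m, n)) (B : 'M[R]_(m, p)) :
  nrm (row_mx A B) = nrm A + nrm B.
Proof.
rewrite -big_split; apply: eq_bigr => i _; rewrite big_split_ord /=.
by congr (_ + _); apply: eq_bigr => j _; rewrite (row_mxEl, row_mxEr).
Qed.

Lemma nrm_col_mx m n p (A : 'M[R]_(m, n)) (B : 'M[R]_(p, n)) :
  nrm (col_mx A B) = nrm A + nrm B.
Proof. by rewrite -nrm_tr tr_col_mx nrm_row_mx !nrm_tr. Qed.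

Lemma nrm_lt_ball m n (A B : 'M[R]_(m, n)) e :
  0 < e -> nrm (A - B) < e -> ball A e B.
Proof.
move=> e0 AB; split=> // i j; rewrite /ball/= (le_lt_trans _ AB)//.
by have := entry_le_nrm (A - B) i j; rewrite !mxE.
Qed.

Lemma cvg_mx_entries m n (u : nat -> 'M[R]_(m, n)) (L : 'M[R]_(m, n)) :
  (forall i j, (fun k => u k i j) @ \oo --> L i j) -> u @ \oo --> L.
Proof.
move=> uL; apply/cvg_ballP => e e0.
have: \forall k \near \oo, forall i j, ball (L i j) e (u k i j).
  apply: filter_forall => i; apply: filter_forall => j.
  by move/cvg_ballP: (uL i j); apply.
by apply: filterS => k uk; split.
Qed.

Lemma cvg_mx_entry m n (u : nat -> 'M[R]_(m, n)) (L : 'M[R]_(m, n))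
    (i : 'I_m) (j : 'I_n) :
  u @ \oo --> L -> (fun k => u k i j) @ \oo --> L i j.
Proof.
move=> /cvg_ballP uL; apply/cvg_ballP => e e0.
by apply: filterS (uL e e0) => k [_]; apply.
Qed.

Lemma cvg_nrm0 m n (u : nat -> 'M[R]_(m, n)) :
  u @ \oo --> (0 : 'M[R]_(m, n)) -> (fun k => nrm (u k)) @ \oo --> 0.
Proof.
move=> u0.
have -> : 0 = \sum_(i < m) \sum_(j < n) `|(0 : 'M[R]_(m, n)) i j|.
  by rewrite -/(nrm 0) nrm0.
apply: cvg_big => [|i _]; first exact: add_continuous.
apply: cvg_big => [|j _]; first exact: add_continuous.
by apply: cvg_norm; apply: cvg_mx_entry u0.
Qed.

End Norm.

(** * Continuity from a Cauchy condition on cylinders *)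

Section Limits.
Context (R : realType) (S : finType) (T : completePseudoMetricType R).

(** The condition is uniform over all words that share a prefix with [w]. Taking [w' = w] gives
    convergence; letting [w'] vary gives continuity. *)
Lemma cvg_words_dC_continuous (g : seq S -> T) :
  (forall w (e : R), 0 < e -> exists k, forall w' m,
    pref k w' = pref k w -> (k <= m)%N ->
    ball (g (pref k w)) e (g (pref m w'))) ->
  (forall w, cvg ((fun k => g (pref k w)) @ \oo)) /\
  dC_continuous (fun w => lim ((fun k => g (pref k w)) @ \oo)).
Proof.
move=> gP.
have cg w : cvg ((fun k => g (pref k w)) @ \oo).
  apply: cauchy_cvg; apply: cauchy_exP => e e0.
  have [k kP] := gP w e e0; exists (g (pref k w)).
  by exists k => // m /= lekm; apply: kP.
split=> // w e e0; have [|k kP] := gP w (e / 4); first by rewrite divr_gt0.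
exists (2^-1 ^+ k) => [|w' /dC_lt_pref eqw].
  by rewrite exprn_gt0 ?invr_gt0.
have e40 : 0 < e / 4 by rewrite divr_gt0.
near \oo => m.
have lekm : (k <= m)%N by near: m; exists k.
have B1 : ball (lim ((fun k => g (pref k w)) @ \oo)) (e / 4) (g (pref m w)).
  by near: m; move/cvg_ballP: (cg w); apply.
have B2 : ball (lim ((fun k => g (pref k w')) @ \oo)) (e / 4) (g (pref m w')).
  by near: m; move/cvg_ballP: (cg w'); apply.
(* Four steps: from the limit at [w] to its prefix of length [m], to the common prefix of length
   [k], to the prefix of [w'] of length [m], to the limit at [w']. *)
have -> : e = (e / 4 + e / 4) + (e / 4 + e / 4).
  by lra.
apply: ball_triangle (ball_triangle B1 (ball_sym (kP _ _ _ lekm))) _ => //.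
exact: ball_triangle (kP _ _ eqw lekm) (ball_sym B2).
Unshelve. all: by end_near. Qed.

End Limits.

(** * Summability of the products of a stable family *)

Section WordProducts.
Context (R : realType) (S : finType) (n : nat) (A : S -> 'M[R]_n).

Lemma word_mx_cons a v : word_mx A (a :: v) = A a *m word_mx A v.
Proof. exact: big_cons. Qed.

Lemma word_mx_cat u v : word_mx A (u ++ v) = word_mx A u *m word_mx A v.
Proof.
elim: u => [|a u IH]; first by rewrite /word_mx big_nil mul1mx.
by rewrite cat_cons !word_mx_cons IH mulmxA.
Qed.

Lemma stableP :
  stable A <->
  forall w i j, (fun k => word_mx A (pref k w) i j) @ \oo --> (0 : R).
Proof.
split=> [[cA lA] w i j|cA].
  have := @cvg_mx_entry _ _ _ _ _ i j (cA w).
  by rewrite -/(limit_mx A w) lA mxE.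
have cA0 w : (fun k => word_mx A (pref k w)) @ \oo --> (0 : 'M[R]_n).
  by apply: cvg_mx_entries => i j; rewrite mxE; apply: cA.
by split=> w; [apply: cvgP (cA0 w) | apply: cvg_lim (cA0 w)].
Qed.

(** The sum of [nrm (B *m word_mx A p)] over all prefixes [p] of [v], the empty one and [v]
    included. *)
Fixpoint path_nrm (B : 'M[R]_n) (v : seq S) : R :=
  nrm B + (if v is a :: v' then path_nrm (B *m A a) v' else 0).

Lemma path_nrm_ge B v : nrm B <= path_nrm B v.
Proof.
rewrite -[leLHS]addr0; elim: v B => [|a v IH] B /=; rewrite lerD2l//.
by rewrite (le_trans _ (IH _))// addr0 nrm_ge0.
Qed.

Lemma path_nrm_ge0 B v : 0 <= path_nrm B v.
Proof. exact: le_trans (nrm_ge0 B) (path_nrm_ge B v). Qed.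

Lemma nrm_word_le_path B v : nrm (B *m word_mx A v) <= path_nrm B v.
Proof.
elim: v B => [|a v IH] B; first by rewrite /word_mx big_nil mulmx1 /= addr0.
by rewrite word_mx_cons mulmxA (le_trans (IH _))//= lerDr nrm_ge0.
Qed.

(** Only an inequality, since the right side counts the term at the cut twice. *)
Lemma path_nrm_cat B u v :
  path_nrm B (u ++ v) <= path_nrm B u + path_nrm (B *m word_mx A u) v.
Proof.
elim: u B => [|a u IH] B /=.
  by rewrite /word_mx big_nil mulmx1 lerDr addr0 nrm_ge0.
by rewrite -addrA lerD2l (le_trans (IH _))// word_mx_cons mulmxA.
Qed.

Lemma path_nrm_mul B C v : path_nrm (B *m C) v <= nrm B * path_nrm C v.
Proof.
elim: v C => [|a v IH] C /=; rewrite mulrDr lerD ?nrm_mul ?mulr0//.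
by rewrite -mulmxA.
Qed.

Lemma path_nrm_bounded_size N :
  exists2 C, 0 <= C & forall v, (size v <= N)%N -> path_nrm 1%:M v <= C.
Proof.
pose a := \sum_b nrm (A b).
have a0 : 0 <= a by apply: sumr_ge0 => b _; apply: nrm_ge0.
(* Reading a letter changes the left factor, so the induction needs a bound for every [B], linear in
   [nrm B]. *)
suff [C C0 CP] : exists2 C, 0 <= C &
    forall B v, (size v <= N)%N -> path_nrm B v <= nrm B * C.
  exists (nrm (1%:M : 'M[R]_n) * C) => [|v]; last exact: CP.
  by rewrite mulr_ge0 ?nrm_ge0.
elim: N => [|N [C C0 CP]].
  by exists 1 => // B [|? ?]//= _; rewrite addr0 mulr1.
exists (1 + a * C) => [|B [|b v]/= lev]; first by rewrite addr_ge0 ?mulr_ge0.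
  by rewrite addr0 mulrDr mulr1 lerDl mulr_ge0 ?nrm_ge0 ?mulr_ge0.
rewrite mulrDr mulr1 lerD2l (le_trans (CP _ _ lev))// mulrA ler_wpM2r//.
rewrite (le_trans (nrm_mul _ _))// ler_wpM2l ?nrm_ge0// /a (bigD1 b)//= lerDl.
by apply: sumr_ge0 => ? _; apply: nrm_ge0.
Qed.

(* By Konig's lemma every long enough word has a nonempty prefix of bounded
   length whose product has norm at most 1/2; cutting there halves the rest. *)
Lemma path_nrm_bounded :
  stable A -> exists2 C, 0 <= C & forall v, path_nrm 1%:M v <= C.
Proof.
move=> sA.
pose P v := (0 < size v)%N /\ nrm (word_mx A v) <= 2^-1.
have [w|N NP] := @konig _ P.
  have [cA lA] := sA; have := cA w; rewrite /= -/(limit_mx A w) => cw.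
  have /cvg_nrm0/cvgr0Pnorm_lt/(_ 2^-1) :
      (fun k => word_mx A (pref k w)) @ \oo --> (0 : 'M[R]_n).
    by rewrite -(lA w); exact: cA.
  rewrite invr_gt0 ltr0n => /(_ isT)[k _ kP].
  exists k.+1; split; first by rewrite size_pref.
  have /= := kP k.+1 (leqnSn k); rewrite ger0_norm ?nrm_ge0//; exact: ltW.
have [C C0 CP] := path_nrm_bounded_size N.
(* The value 2C solves x = C + x/2: the first piece costs at most C, the rest at most half of the
   bound. *)
exists (C + C); first exact: addr_ge0.
move=> v; have [m] := ubnP (size v); elim: m v => // m IH v ltv.
have [lev|/ltnW leN] := leqP (size v) N.
  by rewrite (le_trans (CP _ lev))// lerDl.
have [j lejN [j0 Pj]] := NP v leN.
rewrite -(cat_take_drop j v) (le_trans (path_nrm_cat _ _ _))// lerD//.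
  by apply: CP; rewrite size_take; case: ltnP; lia.
rewrite mul1mx -[word_mx A _]mulmx1 (le_trans (path_nrm_mul _ _ _))//.
have IHd : path_nrm 1%:M (drop j v) <= C + C.
  apply: IH; move: j0 ltv; rewrite size_take_min size_drop; lia.
have := ler_pM (nrm_ge0 _) _ Pj IHd; rewrite path_nrm_ge0 => /(_ isT).
by move=> /le_trans; apply; lra.
Qed.

End WordProducts.

(** * The construction *)

Section Construction.
Context (R : realType) (S L : finType) (n : nat) (A : S -> 'M[R]_n).
Context (sym : L -> S) (vec : L -> 'rV[R]_n).

(** The affine map x -> c + B x in homogeneous coordinates, acting on columns (1, x); products are
    compositions. *)
Definition affine_mx (c : 'cV[R]_n) (B : 'M[R]_n) : 'M[R]_(1 + n) :=
  block_mx 1%:M 0 c B.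

Definition letter_mx (s : L) : 'M[R]_(1 + (1 + n)) :=
  block_mx 0 (row_mx 0 (vec s)) 0 (affine_mx (vec s)^T (A (sym s))).

Definition letter_wfa : wfa R L (1 + (1 + n)) :=
  Wfa (row_mx 1%:M 0) (col_mx 0 (col_mx 1%:M 0)) letter_mx.

(** The translation part of the composed affine maps: the sum over the positions of [u] of the
    product of the earlier symbols applied to the transposed vector. *)
Fixpoint drift (u : seq L) : 'cV[R]_n :=
  if u is s :: u' then (vec s)^T + A (sym s) *m drift u' else 0.

Local Notation sword u := (word_mx A (map sym u)).

Lemma mul_affine_mx c c' B B' :
  affine_mx c B *m affine_mx c' B' = affine_mx (c + B *m c') (B *m B').
Proof.
by rewrite mulmx_block !mul1mx !mul0mx !mulmx0 mulmx1 !addr0 add0r.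
Qed.

Lemma drift_cat u v : drift (u ++ v) = drift u + sword u *m drift v.
Proof.
elim: u => [|s u IH] /=; first by rewrite /word_mx big_nil mul1mx add0r.
by rewrite IH word_mx_cons mulmxDr mulmxA addrA.
Qed.

(** The first column of every letter is zero, so the later letters act only through their affine
    blocks, and the top row comes from the first letter alone. The empty product is the identity,
    hence the restriction to nonempty words. *)
Lemma word_letter_mx s u :
  word_mx letter_mx (s :: u) =
  block_mx 0 (row_mx (vec s *m drift u) (vec s *m sword u))
           0 (affine_mx (drift (s :: u)) (sword (s :: u))).
Proof.
elim: u s => [|s' u IH] s; rewrite word_mx_cons.
  by rewrite /word_mx /= big_cons !big_nil !mulmx1 !mulmx0 addr0.
rewrite IH mulmx_block !mul0mx !mulmx0 !addr0 !add0r mul_affine_mx.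
by rewrite mul_row_block !mul0mx !add0r -(word_mx_cons A).
Qed.

(** The continuation [u] enters through one common right factor. The left factors contain products
    of [A] along the prefix, which become small when [A] is stable. *)
Lemma word_letter_mxB s p u :
  word_mx letter_mx ((s :: p) ++ u) - word_mx letter_mx (s :: p) =
  block_mx 0 (vec s *m sword p *m row_mx (drift u) (sword u - 1%:M))
    0 (col_mx 0 (sword (s :: p) *m row_mx (drift u) (sword u - 1%:M))).
Proof.
have dB q : drift (q ++ u) - drift q = sword q *m drift u.
  by rewrite drift_cat addrC addKr.
have wB q : sword (q ++ u) - sword q = sword q *m (sword u - 1%:M).
  by rewrite map_cat word_mx_cat mulmxBr mulmx1.
rewrite cat_cons !word_letter_mx -cat_cons opp_block_mx add_block_mx.
rewrite opp_row_mx add_row_mx -!mulmxBr dB wB /affine_mx opp_block_mx.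
rewrite add_block_mx dB wB !subrr -!mulmxA !mul_mx_row /block_mx.
by rewrite row_mx0.
Qed.

(** The drift is a sum of prefix products applied to letter vectors, so [path_nrm] times a bound on
    those vectors dominates it. *)
Lemma drift_bounded :
  stable A -> exists2 C, 0 < C &
    forall u, nrm (row_mx (drift u) (sword u - 1%:M)) <= C.
Proof.
move=> /path_nrm_bounded[C C0 CP].
pose V := \sum_s nrm (vec s); have V0 : 0 <= V.
  by apply: sumr_ge0 => s _; apply: nrm_ge0.
have leV s : nrm (vec s) <= V.
  by rewrite /V (bigD1 s)//= lerDl; apply: sumr_ge0 => ? _; apply: nrm_ge0.
have driftP B u : nrm (B *m drift u) <= path_nrm A B (map sym u) * V.
  elim: u B => [|s u IH] B /=.
    by rewrite mulmx0 nrm0 addr0 mulr_ge0 ?nrm_ge0.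
  rewrite mulmxDr mulrDl mulmxA (le_trans (ler_nrmD _ _))// lerD//.
  by rewrite (le_trans (nrm_mul _ _))// nrm_tr ler_wpM2l ?nrm_ge0.
(* [C * V] bounds the drift, the next bracket bounds the product minus the identity, and 1 makes the
   constant positive. *)
exists (C * V + (C + nrm (1%:M : 'M[R]_n)) + 1).
  by rewrite ltr_wpDl ?ltr01// !addr_ge0 ?nrm_ge0 ?mulr_ge0.
move=> u; rewrite nrm_row_mx -[leLHS]addr0 !lerD//.
  by rewrite -[drift u]mul1mx (le_trans (driftP _ _))// ler_wpM2r.
rewrite (le_trans (ler_nrmD _ _))// nrmN lerD2r.
by rewrite -[word_mx _ _]mul1mx (le_trans (nrm_word_le_path _ _ _)).
Qed.

Lemma word_letter_mx_cauchy w (e : R) :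
  stable A -> 0 < e -> exists k, forall w' m, pref k w' = pref k w ->
    (k <= m)%N ->
    nrm (word_mx letter_mx (pref k w) - word_mx letter_mx (pref m w')) < e.
Proof.
move=> sA e0; have [C C0 CP] := drift_bounded sA.
have [cA lA] := sA.
have nrm_cvg0 t : (fun k => nrm (word_mx A (pref k t))) @ \oo --> 0.
  by apply: cvg_nrm0; have := cA t; rewrite /= -/(limit_mx A t) lA.
(* A bound for the change after a prefix of length [k.+1], whatever the continuation: the two terms
   belong to the top row and to the affine block. *)
pose b k := (nrm (vec (w 0%N)) * nrm (word_mx A (pref k (sym \o (w \o succn))))
  + nrm (word_mx A (pref k.+1 (sym \o w)))) * C.
have b0 : b @ \oo --> 0.
  rewrite -(mul0r C); apply: cvgMl; rewrite -[X in _ --> X]addr0.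
  apply: cvgD; last first.
    by have := nrm_cvg0 (sym \o w); rewrite -cvg_shiftS.
  by rewrite -[X in _ --> X](mulr0 (nrm (vec (w 0%N)))); apply: cvgMr.
have [k _ /(_ k (leqnn k)) bk] := (cvgr0Pnorm_lt b).1 b0 e e0.
(* The difference formula needs a nonempty prefix: one first letter, then [k] more. *)
exists k.+1 => w' m eqw /subnKC mE; rewrite -mE prefD eqw.
move: (pref (m - k.+1) _) => u.
rewrite -nrmN opprB prefSl word_letter_mxB.
rewrite /block_mx nrm_col_mx !nrm_row_mx nrm_col_mx !nrm0 !add0r.
apply: le_lt_trans (le_lt_trans (ler_norm _) bk).
rewrite /b mulrDl lerD//.
  rewrite (le_trans (nrm_mul _ _))// map_pref ler_pM ?nrm_ge0//.
  exact: nrm_mul.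
by rewrite (le_trans (nrm_mul _ _))// -prefSl map_pref ler_wpM2l ?nrm_ge0//.
Qed.

Lemma letter_mx_continuous : stable A -> continuous_RCP letter_mx.
Proof.
move=> sA; apply: cvg_words_dC_continuous => w e e0.
have [k kP] := word_letter_mx_cauchy w sA e0.
by exists k => w' m eqw lekm; apply: nrm_lt_ball => //; apply: kP.
Qed.

Lemma letter_wfa_continuous : stable A -> omega_continuous letter_wfa.
Proof.
move=> sA; pose W := letter_wfa.
apply: (@cvg_words_dC_continuous _ _ R^o (fun u =>
  (initial W *m word_mx (trans W) u *m final W) 0 0)) => w e e0.
pose c := nrm (initial W) * nrm (final W).
have c0 : 0 <= c by rewrite mulr_ge0 ?nrm_ge0.
(* Multiplying by [initial] and [final] enlarges norms at most by the factor [c]; adding 1 keeps the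
   divisor positive. *)
have e'0 : 0 < e / (c + 1) by rewrite divr_gt0// ltr_wpDl.
have [k kP] := word_letter_mx_cauchy w sA e'0.
exists k => w' m eqw lekm; rewrite /ball/=.
have := kP w' m eqw lekm; set X := word_mx _ _; set Y := word_mx _ _ => XY.
have -> : (initial W *m X *m final W) 0 0 - (initial W *m Y *m final W) 0 0 =
    (initial W *m (X - Y) *m final W) 0 0.
  by rewrite mulmxBr mulmxBl !mxE.
rewrite (le_lt_trans (entry_le_nrm _ _ _))//.
rewrite (le_lt_trans (nrm_mul _ _))//.
apply: (@le_lt_trans _ _ (c * nrm (X - Y))).
  by rewrite mulrAC ler_wpM2r ?nrm_ge0// nrm_mul.
rewrite ltr_pdivlMr ?ltr_wpDl// in XY.
by apply: le_lt_trans XY; rewrite mulrC ler_wpM2l ?nrm_ge0// lerDl.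
Qed.

(** [initial] and [final] select the second entry of the top row. The first letter contributes its
    vector but not its symbol. *)
Lemma prefix_weight_letter_wfa w k :
  prefix_weight letter_wfa w k.+1 =
  (vec (w 0%N) *m drift (pref k (w \o succn))) 0 0.
Proof.
rewrite /prefix_weight prefSl word_letter_mx /= mul_row_block !mul1mx !mul0mx.
by rewrite !addr0 mul_row_col mulmx0 add0r mul_row_col mulmx1 mulmx0 addr0.
Qed.

Lemma letter_wfa_defined : RCP letter_mx -> omega_defined letter_wfa.
Proof.
move=> cM w; apply/cvg_ex.
exists (limit_mx letter_mx w (lshift _ 0) (rshift 1 (lshift n 0))).
have weightE k : prefix_weight letter_wfa w k.+1 =
    word_mx letter_mx (pref k.+1 w) (lshift _ 0) (rshift 1 (lshift n 0)).
  rewrite prefix_weight_letter_wfa prefSl word_letter_mx.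
  by rewrite block_mxEur row_mxEl.
have := @cvg_mx_entry _ _ _ _ _ (lshift _ 0) (rshift 1 (lshift n 0)) (cM w).
rewrite -cvg_shiftS -[in X in _ -> X]cvg_shiftS; apply: cvg_trans.
by apply: near_eq_cvg; near=> k; rewrite /= weightE.
Unshelve. all: by end_near. Qed.

Lemma stable_of_letter_wfa_defined :
  (forall a i, exists s, sym s = a /\ vec s = delta_mx 0 i) ->
  omega_defined letter_wfa -> stable A.
Proof.
move=> full dW; apply/stableP => w i j.
have /choice[f fP] k := full (w k) j.
have [s [symE vecE]] := full (w 0%N) i.
(* The first letter carries e_i; the following ones spell [w], each with vector e_j. Consecutive
   weights then differ by e_i A_v e_j^T with v a prefix of [w], which is the entry (i, j). *)
pose w' k := if k is k'.+1 then f k' else s.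
have /cvg_ex[l] := dW w'; rewrite -cvg_shiftS => wl.
have wl1 := wl; rewrite -cvg_shiftS in wl1.
suff -> : (fun k => word_mx A (pref k w) i j) =
    (fun k => prefix_weight letter_wfa w' k.+2 -
              prefix_weight letter_wfa w' k.+1).
  by rewrite -[X in _ --> X](subrr l); apply: cvgB.
apply/funext => k; rewrite !prefix_weight_letter_wfa.
rewrite -[w' \o succn]/f prefS -cats1 drift_cat mulmxDr.
rewrite [in RHS]mxE addrAC subrr add0r.
have -> : map sym (pref k f) = pref k w.
  by rewrite map_pref; congr pref; apply/funext => m; have [] := fP m.
have [_ fj] := fP k; rewrite /= mulmx0 addr0 fj vecE trmx_delta.
by rewrite mulmxA -rowE -colE !mxE.
Qed.

(** A letter sends F to F plus its transposed vector in the last block, so the error in the average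
    is the sum of all vectors. *)
Lemma letter_wfa_average_preserving :
  \sum_s vec s = 0 -> average_preserving letter_wfa.
Proof.
move=> vec0.
have letterE s : letter_mx s *m final letter_wfa =
    final letter_wfa + col_mx 0 (col_mx 0 (vec s)^T).
  rewrite mul_block_col mul_row_col mul_block_col !mulmx0 !mul0mx !mulmx1.
  by rewrite !addr0 !add0r /= !add_col_mx !addr0 add0r.
rewrite /average_preserving (eq_bigr _ (fun s _ => letterE s)) big_split /=.
rewrite sumr_const -scaler_nat -[RHS]addr0; congr (_ + _).
pose f c := col_mx 0 (col_mx 0 c^T) : 'cV[R]_(1 + (1 + n)).
have f0 : f 0 = 0 by rewrite /f trmx0 !col_mx0.
have fD : {morph f : x y / x + y}.
  by move=> x y; rewrite /f linearD !add_col_mx !addr0.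
by rewrite -(big_morph f fD f0) vec0.
Qed.

End Construction.

(** * Codes of the constructed inputs *)

Section ScaledUnits.
Context (R : pzRingType).
Implicit Types (c : R) (n : nat).

Lemma size_scaled_units c n l : l \in scaled_units c n -> size l = n.
Proof.
elim: n l => [|n IH] l /=; first by rewrite inE => /eqP->.
rewrite inE => /predU1P[->|/mapP[l' l'n ->]] /=; first by rewrite size_nseq.
by rewrite IH.
Qed.

Lemma scaled_unitsN c n :
  scaled_units (- c) n = [seq map -%R l | l <- scaled_units c n].
Proof.
elim: n => //= n ->; rewrite map_nseq oppr0 -!map_comp; congr (_ :: _).
by apply: eq_map => l /=; rewrite oppr0.
Qed.

Lemma mem_scaled_units c n (i : 'I_n) :
  exists2 l, l \in scaled_units c n & forall j, l`_j = c *+ (j == i).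
Proof.
elim: n i => [[]//|n IH] i; case: (unliftP ord0 i) => [i' ->|->].
  have [l ln lE] := IH i'; exists (0 :: l) => [|[|j]//=].
  by rewrite inE mem_map ?ln ?orbT// => x y [].
exists (c :: nseq n 0) => [|[|j]//=]; first by rewrite mem_head.
by rewrite nth_nseq if_same.
Qed.

End ScaledUnits.

(** * Row lists of the new matrices *)

Section MatrixRows.
Context (R : realType).

Definition mx_rows (m n : nat) (A : 'M[R]_(m, n)) : seq (seq R) :=
  [seq [seq A i j | j <- enum 'I_n] | i <- enum 'I_m].

Definition row_of (n : nat) (l : seq R) : 'rV[R]_n := \row_j l`_j.

Lemma row_ofK n l : size l = n -> [seq row_of n l 0 j | j <- enum 'I_n] = l.
Proof.
move=> sl; under eq_map do rewrite mxE.
rewrite (map_comp (nth 0 l) val) val_enum_ord -sl map_nth_iota0//.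
exact: take_size.
Qed.

Lemma map_const_enum (T : Type) (x : T) n : [seq x | _ <- enum 'I_n] = nseq n x.
Proof. by rewrite -[in RHS](size_enum_ord n); elim: (enum _) => //= i l ->. Qed.

Lemma enum_ord2D n :
  enum 'I_(1 + (1 + n)) = [:: lshift (1 + n) 0, rshift 1 (lshift n 0) &
    [seq rshift 1 (rshift 1 i) | i <- enum 'I_n]].
Proof.
rewrite enum_ordSl [enum _]enum_ordSl /= -map_comp.
congr [:: _, _ & _]; try exact: val_inj.
by apply: eq_map => i; apply: val_inj.
Qed.

Lemma mx_rows_letter (L S : finType) n (A : S -> 'M[R]_n) (sym : L -> S)
    (vec : L -> 'rV[R]_n) s :
  mx_rows (letter_mx A sym vec s) =
  letter_rows n [seq vec s 0 j | j <- enum 'I_n] (mx_rows (A (sym s))).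
Proof.
rewrite /mx_rows /letter_rows enum_ord2D /= zip_map.
rewrite /letter_mx /affine_mx.
congr [:: [:: _, _ & _], [:: _, _ & _] & _].
- by rewrite block_mxEul mxE.
- by rewrite block_mxEur row_mxEl mxE.
- by rewrite -map_comp; apply: eq_map => j; rewrite /= block_mxEur row_mxEr.
- by rewrite block_mxEdl mxE.
- by rewrite block_mxEdr block_mxEul mxE eqxx.
- rewrite -map_comp -map_const_enum; apply: eq_map => j.
  by rewrite /= block_mxEdr block_mxEur mxE.
rewrite -!(map_comp _ _ (enum 'I_n)); apply: eq_map => i /=.
congr [:: _, _ & _].
- by rewrite block_mxEdl mxE.
- by rewrite block_mxEdr block_mxEdl mxE.
- by rewrite -map_comp; apply: eq_map => j; rewrite /= !block_mxEdr.
Qed.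

Lemma mx_rows_initial n :
  mx_rows (row_mx 1%:M 0 : 'rV[R]_(1 + (1 + n))) = [:: [:: 1, 0 & nseq n 0]].
Proof.
rewrite /mx_rows [enum 'I_1]enum_ordSl enum_ord0 enum_ord2D /=.
rewrite -(map_comp _ _ (enum 'I_n)).
congr [:: [:: _, _ & _]].
- by rewrite (row_mxEl _ _ ord0) mxE eqxx.
- by rewrite row_mxEr mxE.
- by rewrite -map_const_enum; apply: eq_map => j; rewrite /= row_mxEr mxE.
Qed.

Lemma mx_rows_final n :
  mx_rows (col_mx 0 (col_mx 1%:M 0) : 'cV[R]_(1 + (1 + n))) =
  [:: [:: 0], [:: 1] & nseq n [:: 0]].
Proof.
rewrite /mx_rows [enum 'I_1]enum_ordSl enum_ord0 enum_ord2D /=.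
rewrite -(map_comp _ _ (enum 'I_n)).
congr [:: [:: _], [:: _] & _].
- by rewrite col_mxEu mxE.
- by rewrite col_mxEd col_mxEu mxE.
- by rewrite -map_const_enum; apply: eq_map => j; rewrite /= !col_mxEd mxE.
Qed.

End MatrixRows.

Lemma letters_map (R : pzRingType) (T U : Type) (f : T -> U) n s :
  letters R n (map f s) = [seq (p.1, f p.2) | p <- letters R n s].
Proof. by rewrite /letters map_allpairs allpairs_mapr. Qed.

(** * The new alphabet as positions in a list *)

Section Family.
Context (R : realType) (A : matrix_family R).
Let n := mf_dim A.
Let P := letters R n (enum 'I_(mf_alph A).+1).

Lemma size_family_letters : size P = (size P).-1.+1.
Proof.
rewrite prednK// size_allpairs size_enum_ord muln_gt0 andbT size_cat.
by case: n.
Qed.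

(** Inputs have ordinals as letters, so a letter is a position in [P]. Pairs with the zero vector
    occur twice and give distinct letters. *)
Definition family_letter (s : 'I_(size P).-1.+1) : seq R * 'I_(mf_alph A).+1 :=
  nth ([::], ord0) P s.
Definition family_sym s := (family_letter s).2.
Definition family_vec s := row_of n (family_letter s).1.

(** Transfers both the row lists and the sum of the vectors from positions to the list [P]
    itself. *)
Lemma map_family_letter (T : Type) (f : seq R * 'I_(mf_alph A).+1 -> T) :
  [seq f (family_letter s) | s <- enum 'I_(size P).-1.+1] = [seq f p | p <- P].
Proof.
rewrite (map_comp f) /family_letter (map_comp (nth _ P) val) val_enum_ord.
by rewrite -size_family_letters map_nth_iota0// take_size.
Qed.

Lemma family_letter_mem p : p \in P -> exists s, family_letter s = p.
Proof.
move=> /(nthP ([::], ord0))[i ltiP <-].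
rewrite size_family_letters in ltiP.
by exists (Ordinal ltiP).
Qed.

Lemma size_family_letter s : size (family_letter s).1 = n.
Proof.
have : family_letter s \in P.
  by rewrite mem_nth// [ltnRHS]size_family_letters.
case/allpairsP => -[v a] /= [+ _ ->]; rewrite mem_cat.
by case/orP => /size_scaled_units.
Qed.

Lemma family_full a (i : 'I_n) :
  exists s, family_sym s = a /\ family_vec s = delta_mx 0 i.
Proof.
have [l ln lE] := mem_scaled_units (1 : R) i.
have [|s sE] := @family_letter_mem (l, a).
  by apply/allpairsP; exists (l, a); rewrite /= mem_cat ln mem_enum.
exists s; rewrite /family_sym /family_vec sE; split=> //.
by apply/rowP => j; rewrite !mxE lE eqxx.
Qed.

Lemma sum_family_vec : \sum_s family_vec s = 0.
Proof.
pose F (p : seq R * 'I_(mf_alph A).+1) := row_of n p.1.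
transitivity (\sum_(p <- P) F p).
  by rewrite -[in RHS](map_id P) -map_family_letter big_map big_enum.
rewrite /P big_allpairs big_cat /= scaled_unitsN big_map.
rewrite -big_split big1// => v _.
rewrite -big_split big1// => a _; apply/rowP => j; rewrite !mxE.
have [ltj|lej] := ltnP j (size v); last first.
  by rewrite !nth_default ?size_map// addr0.
by rewrite (nth_map 0)// subrr.
Qed.
End Family.

Definition letter_family (R : realType) (A : matrix_family R) :
    matrix_family R :=
  MatrixFamily (letter_mx A (@family_sym R A) (@family_vec R A)).

Definition letter_apwfa (R : realType) (A : matrix_family R) : apwfa R :=
  ApWfa (letter_wfa_average_preserving A (@family_sym R A)
    (@sum_family_vec R A)).

Definition family_rows (R : realType) (n k : nat) (A : 'I_k.+1 -> 'M[R]_n) :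
    seq (seq (seq R)) :=
  [seq mx_rows (A a) | a <- enum 'I_k.+1].

(** Identifies the list that the program computes with the rows of the constructed matrices, in the
    order of the new alphabet. *)
Lemma family_rows_letter (R : realType) (A : matrix_family R) :
  family_rows (letter_family A) =
  [seq letter_rows (mf_dim A) p.1 p.2 |
    p <- letters R (mf_dim A) (family_rows A)].
Proof.
rewrite /family_rows letters_map -[RHS]map_comp.
rewrite -[RHS](map_family_letter
  (fun p => letter_rows _ p.1 (mx_rows (A p.2)))).
apply: eq_map => s; rewrite mx_rows_letter row_ofK//.
exact: size_family_letter.
Qed.

(** * Programs computing the new inputs *)

Lemma names_seq_map (T U : Type) (r : data -> U -> Prop) (f : T -> U) d s :
  names_seq r d (map f s) <-> names_seq (fun e x => r e (f x)) d s.
Proof.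
elim: s d => [|x s IH] [|d1 d2] //=.
by split=> -[rx /IH].
Qed.

Lemma names_seq_units d n :
  names_seq names_unit d (nseq n tt) <-> d = nat_data n.
Proof.
split=> [|->]; last by elim: n.
by elim: n d => [|n IH] [|d1 d2] //= [-> /IH->].
Qed.

(** The program is kept and only the reading of its output changes, for instance from a pair of
    lists to a matrix family. *)
Lemma realizes_recode (X Y Z : Type) (r : data -> X -> Prop)
    (s : data -> Y -> Prop) (t : data -> Z -> Prop) (f : X -> Y) (g : X -> Z) :
  realizes r s f -> (forall d x, s d (f x) -> t d (g x)) -> realizes r t g.
Proof.
move=> [p pP] st; exists p => Q d x rx.
by have [e de /st te] := pP Q d x rx; exists e.
Qed.

(** A many-one reduction: a single question is asked, at the end, and its answer is returned
    unchanged. *)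
Lemma reducible_of_realizes (X Y : problem) (f : input X -> input Y) :
  realizes (@encodes X) (@encodes Y) f -> (forall x, yes x <-> yes (f x)) ->
  reducible X Y.
Proof.
move=> [p pP] fP; exists (Seq p Ask) => d x dx.
have [e de ex] := pP (oracle Y) d x dx.
(* The answer is chosen classically as the truth value of [yes (f x)]; [oracle Y] admits it because
   [f x] has the code computed by [p]. *)
exists `[< yes (f x) >]; split; last by rewrite fP; split => /asboolP.
by apply: EvalSeq de _; constructor; exists (f x); split=> //; split=> /asboolP.
Qed.

Section Programs.
Context (R : realType) (names : data -> R -> Prop).
Hypothesis hK : effective_field names.

Let names_rows := names_seq (names_seq (names_seq names)).

Lemma names_familyE d n k (A : 'I_k.+1 -> 'M[R]_n) :
  names_family names d A <-> names_rows d (family_rows A).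
Proof.
rewrite /names_family /family_rows /names_rows.
by rewrite (map_comp (@mx_rows R n n) A) (names_seq_map _ (@mx_rows R n n)).
Qed.

Let family_code := @encodes_matrix_family R names.

Lemma realizes_dim : realizes family_code (names_seq names_unit)
  (fun A => nseq (mf_dim A) tt).
Proof.
exists Hd => Q _ A [dA [-> _]]; exists (nat_data (mf_dim A)).
  exact: (EvalHd _ (Node _ _)).
exact/names_seq_units.
Qed.

Lemma realizes_rows : realizes family_code names_rows (fun A => family_rows A).
Proof.
exists Tl => Q _ A [dA [-> rA]]; exists dA; first exact: (EvalTl _ (Node _ _)).
exact/names_familyE.
Qed.

Lemma realizes_letter_dim : realizes family_code (names_seq names_unit)
  (fun A => nseq (mf_dim A).+2 tt).
Proof.
have rtt X (r : data -> X -> Prop) : realizes r names_unit (fun=> tt).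
  exact: (@realizes_const _ _ _ _ Leaf).
exact: realizes_cons (rtt _ _) (realizes_cons (rtt _ _) realizes_dim).
Qed.

Lemma realizes_letter_family_rows :
  realizes family_code names_rows (fun A => family_rows (letter_family A)).
Proof.
have := realizes_comp (realizes_pair realizes_dim realizes_rows)
  (realizes_letters_rows hK).
by apply: realizes_ext => A; rewrite /= size_nseq family_rows_letter.
Qed.

Lemma realizes_letter_family :
  realizes family_code family_code (@letter_family R).
Proof.
apply: realizes_recode
  (realizes_pair realizes_letter_dim realizes_letter_family_rows) _.
move=> [//|d1 d2] A [/names_seq_units d1E /names_familyE d2A].
by exists d2; rewrite d1E.
Qed.

Lemma realizes_letter_apwfa :
  realizes family_code (@encodes_apwfa R names) (@letter_apwfa R).
Proof.
have [[d0 e0] [d1 e1] _] := names_0N1 hK.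
have r0 : realizes family_code names (fun=> 0) by apply: realizes_const e0.
have r1 : realizes family_code names (fun=> 1) by apply: realizes_const e1.
have rnil X (s : data -> X -> Prop) := realizes_nil family_code s.
have rI : realizes family_code (names_seq (names_seq names))
    (fun A => [:: [:: 1, 0 & nseq (mf_dim A) 0]]).
  do 3![apply: realizes_cons => //].
  exact: realizes_nseq realizes_dim _ _ _ _ e0.
have rF : realizes family_code (names_seq (names_seq names))
    (fun A => [:: [:: 0], [:: 1] & nseq (mf_dim A) [:: 0]]).
  apply: realizes_cons; first exact: realizes_cons.
  apply: realizes_cons; first exact: realizes_cons.
  by apply: (realizes_nseq realizes_dim (e := Node d0 Leaf)).
apply: realizes_recode (realizes_pair realizes_letter_dim
  (realizes_pair rI (realizes_pair rF realizes_letter_family_rows))) _.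
move=> [//|dn d] A [/names_seq_units -> ].
case: d => [//|dI d] [nI]; case: d => [//|dF dA] [nF /names_familyE nA].
exists dI, dF, dA; split=> //.
- by rewrite /names_matrix -/(mx_rows _) mx_rows_initial.
- by rewrite /names_matrix -/(mx_rows _) mx_rows_final.
Qed.

End Programs.

(** * Stability against convergence and continuity *)

Section Equivalences.
Context (R : realType) (A : matrix_family R).

Lemma stable_of_letter_apwfa : omega_defined (letter_apwfa A) -> stable A.
Proof. exact/stable_of_letter_wfa_defined/family_full. Qed.

Lemma stable_of_letter_family : RCP (letter_family A) -> stable A.
Proof. by move=> /letter_wfa_defined/stable_of_letter_apwfa. Qed.

Lemma stable_letter_apwfa : stable A -> omega_continuous (letter_apwfa A).
Proof. exact: letter_wfa_continuous. Qed.

Lemma stable_letter_family : stable A -> continuous_RCP (letter_family A).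
Proof. exact: letter_mx_continuous. Qed.

End Equivalences.

Theorem theorem47 (R : realType) (names : data -> R -> Prop)
    (hK : effective_field names) :
  reducible (matrix_product_stability names) (apwfa_convergence names) /\
  reducible (matrix_product_stability names) (apwfa_continuity names) /\
  reducible (matrix_product_stability names)
    (matrix_product_convergence names) /\
  reducible (matrix_product_stability names)
    (matrix_product_continuity names).
Proof.
have rW := realizes_letter_apwfa hK; have rM := realizes_letter_family hK.
(* In each case the implications close a circle: stability gives continuity, which includes
   convergence, and convergence gives stability back. *)
split; [|split; [|split]].
- apply: (@reducible_of_realizes (matrix_product_stability names)
    (apwfa_convergence names) _ rW) => A; split.
    by case/stable_letter_apwfa.
  exact: stable_of_letter_apwfa.
- apply: (@reducible_of_realizes (matrix_product_stability names)
    (apwfa_continuity names) _ rW) => A; split.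
    exact: stable_letter_apwfa.
  by case=> /stable_of_letter_apwfa.
- apply: (@reducible_of_realizes (matrix_product_stability names)
    (matrix_product_convergence names) _ rM).
  move=> A; split; first by case/stable_letter_family.
  exact: stable_of_letter_family.
- apply: (@reducible_of_realizes (matrix_product_stability names)
    (matrix_product_continuity names) _ rM).
  move=> A; split; first exact: stable_letter_family.
  by case=> /stable_of_letter_family.
Qed.
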